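(* Let $\mathbb{F}$ be any field. There is, up to isomorphism, a unique nilpotent symplectic alternating algebra $L$ over $\mathbb{F}$ of dimension $10$ with an isotropic center of dimension $4$ and where $L^3=Z(L)$ that is of type $A$. This algebra can be given by the presentation $$\mathcal{P}_{10}^{(4,2)}:\quad (x_1y_2,y_3)=1,\ (y_1y_4,y_5)=1.$$
   Context: A symplectic alternating algebra (SAA) over a field $\mathbb{F}$ is a finite-dimensional vector space $L$ over $\mathbb{F}$ with a non-degenerate alternating bilinear form $(\ ,\ )$ and a bilinear product $\cdot$ satisfying $u\cdot u=0$ for all $u$ and $(u\cdot v,w)=(v\cdot w,u)$ for all $u,v,w\in L$. No associativity or Jacobi identity is assumed. The map $(u,v,w)\mapsto(uv,w)$ is then an alternating trilinear form. A standard basis (in dimension $10$) is a basis $x_1,y_1,\ldots,x_5,y_5$ with $(x_i,x_j)=(y_i,y_j)=0$ and $(x_i,y_j)=\delta_{ij}$ for all $i,j$. Presentations: $L$ is given by a presentation if there is a standard basis for which the listed values of triples $(uv,w)$ hold and $(uv,w)=0$ for all triples of basis elements that are not a reordering of a listed one. Isomorphisms are linear bijections preserving product and form. $L^1=L$, $L^{m+1}=L^mL$ (span of products). $L$ is nilpotent if $L^{m+1}=\{0\}$ for some $m\ge 0$. The center is $Z(L)=\{x\in L: xL=\{0\}\}$; it is isotropic if $(u,v)=0$ for all $u,v\in Z(L)$. Type $A$: let $L$ be nilpotent of dimension $10$ with isotropic center of dimension $4$ and $L^3=Z(L)$. Then $L^2=Z(L)^{\perp}$ is abelian of dimension $6$,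 so $L^2/Z(L)$ has dimension $2$ and $L/L^2$ has dimension $4$. For each $\bar z=z+Z(L)\in L^2/Z(L)$ there is a well-defined alternating form $\phi_{\bar z}:L/L^2\times L/L^2\to\mathbb{F}$, $\phi_{\bar z}(u+L^2,v+L^2)=(zu,v)$. $L$ is of type $A$ if there exists a basis $\bar z,\bar t$ of $L^2/Z(L)$ such that $\phi_{\bar z}$ and $\phi_{\bar t}$ are both degenerate. *)

(* Defs.v *)
From HB Require Import structures.
From mathcomp Require Import all_boot all_algebra.

Set Implicit Arguments.
Unset Strict Implicit.
Unset Printing Implicit Defensive.

Import GRing.Theory.
Local Open Scope ring_scope.

Record saa (F : fieldType) := SAA {
  saa_carrier :> vectType F;
  form : {biscalar saa_carrier};
  mul : {bilinear saa_carrier -> saa_carrier -> saa_carrier};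
  form_alt : forall u, form u u = 0;
  form_nondeg : forall u, (forall v, form u v = 0) -> u = 0;
  mul_alt : forall u, mul u u = 0;
  form_mul : forall u v w, form (mul u v) w = form (mul v w) u
}.

Arguments form {F} s.
Arguments mul {F} s.

Section Theory.
Variables (F : fieldType) (L : saa F).
Implicit Types U V W : {vspace L}.

(* It is enough to multiply basis vectors; see prod_vsP. *)
Definition prod_vs U V : {vspace L} :=
  <<[seq mul L u v | u <- vbasis U, v <- vbasis V]>>%VS.

Lemma prod_vsP U V W :
  reflect (forall u v, u \in U -> v \in V -> mul L u v \in W)
          (prod_vs U V <= W)%VS.
Proof.
apply: (iffP idP) => [sUVW u v uU vV | sUVW].
  apply: (subvP sUVW); rewrite (coord_vbasis uU) (coord_vbasis vV).
  rewrite linear_sumlz memv_suml // => i _.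
  rewrite linearZl_LR memvZ // linear_sumr memv_suml // => j _.
  rewrite linearZr_LR memvZ // memv_span //.
  by apply: allpairs_f; apply: mem_nth; rewrite size_tuple.
apply/span_subvP=> _ /allpairsP[[u v] /= [uU vV ->]].
by apply: sUVW; apply: vbasis_mem.
Qed.

(* L^m for m >= 1, with L^{m+1} = L^m L; the value at m = 0 is junk. *)
Definition lpow (m : nat) : {vspace L} :=
  iter m.-1 (fun U => prod_vs U fullv) fullv.

Definition saa_nilpotent := exists m : nat, lpow m.+1 = 0%VS.

Definition center : {vspace L} :=
  lker (linfun (fun x : L => linfun (mul L x) : 'Hom(L, L))).

Lemma memv_center x : (x \in center) <-> (forall y, mul L x y = 0).
Proof.
have lin : linear (fun x : L => linfun (mul L x) : 'Hom(L, L)).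
  move=> a u v; apply/lfunP=> y; rewrite add_lfunE scale_lfunE !lfunE /=.
  by rewrite linearPl.
pose h := HB.pack_for {linear L -> 'Hom(L, L)} (fun x : L => linfun (mul L x))
  (GRing.isLinear.Build _ _ _ _ _ lin).
rewrite /center memv_ker -[X in linfun X]/(h : L -> _) lfunE /=.
split=> [/eqP h0 y | h0].
  by have := congr1 (fun g : 'Hom(L, L) => g y) h0; rewrite lfunE zero_lfunE.
by apply/eqP/lfunP=> y; rewrite lfunE zero_lfunE /= h0.
Qed.

Definition isotropic U := forall u v, u \in U -> v \in U -> form L u v = 0.

(* Quotients of subspaces are handled through representatives:
   basis_mod U W s says that W <= U and that the cosets modulo W of the vectors
   of s form a basis of U / W (without repetition). *)
Definition basis_mod U W (s : seq L) : Prop :=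
  [/\ free s, (<<s>> :&: W = 0)%VS & (<<s>> + W = U)%VS].

(* The form induced by b on L / W has a nonzero vector in its radical. *)
Definition degenerate_mod W (b : L -> L -> F) : Prop :=
  exists2 u : L, u \notin W & forall v : L, b u v = 0.

(* phi z u v is the value of the form attached to z + Z(L) at the pair
   (u + L^2, v + L^2); see phi_wd for the independence of representatives. *)
Definition phi (z u v : L) : F := form L (mul L z u) v.

Lemma form_opp u v : form L u v = - form L v u.
Proof.
apply/eqP; rewrite -addr_eq0; apply/eqP.
have := form_alt (u + v).
by rewrite linearDl /= !linearDr /= !form_alt add0r addr0.
Qed.

Lemma phi_wd z z' u u' v v' :
  lpow 3 = center -> z \in lpow 2 -> z - z' \in center ->
  u - u' \in lpow 2 -> v - v' \in lpow 2 -> phi z u v = phi z' u' v'.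
Proof.
move=> L3Z z2 zz uu vv.
have c0 c y : c \in center -> mul L c y = 0 by move/memv_center.
have L2L a b : a \in lpow 2 -> mul L a b \in center.
  by move=> a2; rewrite -L3Z; apply: (prod_vsP _ _ _ (subvv (lpow 3)));
     rewrite ?memvf.
have cform c a b : c \in center -> form L (mul L a b) c = 0.
  by move=> cZ; rewrite form_mul form_mul c0 // linear0l.
have cL2 c a : c \in center -> a \in lpow 2 -> form L c a = 0.
  move=> cZ a2; have : (lpow 2 <= lker (linfun (form L c : L -> F^o)))%VS.
    apply/prod_vsP=> x y _ _; rewrite memv_ker lfunE /=.
    by rewrite form_opp cform // oppr0.
  by move/subvP/(_ a a2); rewrite memv_ker lfunE => /eqP.
rewrite /phi -[z in LHS](subrK z') linearDl /= c0 // add0r.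
have z'2 : z' \in lpow 2.
  rewrite -[z'](subKr z) memvB //.
  apply: subvP zz; rewrite -L3Z; apply/prod_vsP=> a b _ _.
  by apply: (prod_vsP _ _ _ (subvv (lpow 2))); rewrite ?memvf.
have h w : form L (mul L z' (u - u')) w = 0.
  by rewrite form_mul cL2 //; apply: L2L.
rewrite -[u in LHS](subrK u') linearDr /= linearDl /= h add0r.
rewrite -[v in LHS](subrK v') linearDr /= cL2 ?add0r //; exact: L2L.
Qed.

Definition type_A : Prop := exists z t : L,
  [/\ basis_mod (lpow 2) center [:: z; t],
      degenerate_mod (lpow 2) (phi z) & degenerate_mod (lpow 2) (phi t)].

(* The standing assumptions on L, other than its type. *)
Definition saa_10_4 : Prop :=
  [/\ saa_nilpotent, \dim {:L} = 10%N, isotropic center, \dim center = 4%N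
    & lpow 3 = center].

(* A family indexed by 'I_n + 'I_n stands for x_1,..,x_n (inl), y_1,..,y_n
   (inr). *)
Definition standard_basis (n : nat) (e : 'I_n + 'I_n -> L) : Prop :=
  [/\ basis_of fullv (codom e),
      forall i j, form L (e (inl i)) (e (inl j)) = 0,
      forall i j, form L (e (inr i)) (e (inr j)) = 0
    & forall i j, form L (e (inl i)) (e (inr j)) = (i == j)%:R].

End Theory.

(* A presentation lists items ((a, b, c), r), meaning (e_a e_b, e_c) = r. *)
Definition presentation (F : fieldType) (n : nat) :=
  seq (('I_n + 'I_n) * ('I_n + 'I_n) * ('I_n + 'I_n) * F).

Definition given_by (F : fieldType) (L : saa F) (n : nat)
    (P : presentation F n) : Prop :=
  exists e : 'I_n + 'I_n -> L,
  [/\ standard_basis e,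
      forall a b c r, (a, b, c, r) \in P -> form L (mul L (e a) (e b)) (e c) = r
    & forall a b c,
        (forall a' b' c' r, (a', b', c', r) \in P ->
           ~~ perm_eq [:: a; b; c] [:: a'; b'; c']) ->
        form L (mul L (e a) (e b)) (e c) = 0].

(* Basis indices of dimension 10, numbered from 1 to 5. *)
Notation "''x_' k" := (inl (@Ordinal 5 k.-1 isT))
  (at level 8, k at level 2, only parsing).
Notation "''y_' k" := (inr (@Ordinal 5 k.-1 isT))
  (at level 8, k at level 2, only parsing).

Definition P10_4_2 (F : fieldType) : presentation F 5 :=
  [:: ('x_1, 'y_2, 'y_3, 1); ('y_1, 'y_4, 'y_5, 1)].

Definition saa_iso (F : fieldType) (L M : saa F) : Prop :=
  exists f : {linear L -> M},
  [/\ bijective f,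
      forall u v, f (mul L u v) = mul M (f u) (f v)
    & forall u v, form M (f u) (f v) = form L u v].

(* Main.v *)
From HB Require Import structures.
From mathcomp Require Import all_boot all_algebra ring.
Require Import Defs.

Set Implicit Arguments.
Unset Strict Implicit.
Unset Printing Implicit Defensive.

Import GRing.Theory.
Local Open Scope ring_scope.

(** Write Z = Z(L) and let phi u v w = (uv, w), an alternating trilinear form.

    Since (uv, c) = phi u v c vanishes for all u and v exactly when c is
    central, Z is the orthogonal of L^2, and by non-degeneracy L^2 is the
    orthogonal of Z; hence dim L^2 = 10 - 4 = 6, and L^3 = Z makes L^2
    abelian. Take a basis z, t of L^2 modulo Z whose two forms on the
    4-dimensional space L / L^2 are degenerate. Each of these forms is nonzero
    and alternating, so its rank is even, hence exactly 2: the annihilator of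
    z, which is the radical of the form of z, has dimension at least 8
    (dim_annihilator_ge), and so has that of t. An element killed by both z
    and t is orthogonal to L^2 L = L^3 = Z, so it is in L^2. Counting
    dimensions, the two annihilators span L and meet in L^2, that is, L / L^2
    is the direct sum of the two radicals. A basis y4, y5 of the radical for z
    and a basis y2, y3 of the radical for t can be scaled so that phi z y2 y3
    = phi t y4 y5 = 1, and likewise (z, t) = 1 (hyperbolic_frame).

    The rest consists of corrections. Adding multiples of z to y4, y5 and
    multiples of t to y2, y3 kills the four values phi y_i y_j y_k
    (adapted_frame). Changing vectors by central ones does not affect phi, and
    pairing with Z allows every linear form on L / L^2, so central corrections
    make the y_i orthogonal to one another and to z and t, while the basis of
    Z dual to the y_i supplies x2, ..., x5. With x1 = z and y1 = t this is the
    presentation (type_A_given_by).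

    Two algebras with the same presentation are isomorphic because phi and the
    form determine the product (given_by_iso). Existence is a computation in
    coordinates in the algebra that the presentation describes. *)

(** * Linear algebra and alternating functions *)

(** Used to extend to a span a property of a single variable of a form or of a
    product, without having to package the partial application as a linear
    map. *)
Lemma span_ind (F : fieldType) (V : vectType F) (P : V -> Prop) (X : seq V) :
  P 0 -> (forall k u v, P u -> P v -> P (k *: u + v)) ->
  (forall u, u \in X -> P u) -> forall u, u \in <<X>>%VS -> P u.
Proof.
move=> P0 PD PX u /(coord_span (X := in_tuple X)) ->.
elim/big_rec: _ => // i v _ Pv; apply: PD => //.
by apply: PX; rewrite mem_nth.
Qed.

(** The permutations of three letters act on D by a sign; only the vanishing
    of D is needed afterwards, so the sign itself is not recorded. *)
Lemma alternating_perm_eq0 (I : eqType) (V : zmodType) (D : I -> I -> I -> V)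
    (a b c a' b' c' : I) :
  (forall x y z : I, D x y z = D y z x) ->
  (forall x y z : I, D x y z = - D y x z) ->
  perm_eq [:: a; b; c] [:: a'; b'; c'] -> D a' b' c' = 0 -> D a b c = 0.
Proof.
move=> rot swap /(perm_iotaP a)[Is]; rewrite -mem_permutations.
rewrite (_ : permutations _ = [:: [:: 1; 0; 2]; [:: 0; 1; 2]; [:: 2; 0; 1];
  [:: 0; 2; 1]; [:: 1; 2; 0]; [:: 2; 1; 0]]%N); last by vm_compute.
move=> + + D0; have D0' : D b' a' c' = 0 by rewrite swap D0 oppr0.
have rot0 (x y z : I) : D y z x = 0 -> D x y z = 0 by move=> h; rewrite rot.
have rot0' (x y z : I) : D z x y = 0 -> D x y z = 0 by move=> h; rewrite -rot.
rewrite !inE => pIs eIs.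
by move: pIs eIs => /or4P[|||/or3P[]] /eqP-> [-> -> ->]; auto.
Qed.

Lemma ord5_ind (P : 'I_5 -> Prop) :
  P (@Ordinal 5 0 isT) -> P (@Ordinal 5 1 isT) -> P (@Ordinal 5 2 isT) ->
  P (@Ordinal 5 3 isT) -> P (@Ordinal 5 4 isT) -> forall i, P i.
Proof.
move=> P0 P1 P2 P3 P4 [[|[|[|[|[|//]]]]] i5].
all: by rewrite (bool_irrelevance i5 isT).
Qed.

(** * The form phi u v w = (uv, w), duality and the center *)

Section General.
Variables (F : fieldType) (L : saa F).
Local Notation "<| u , v |>" := (form L u v).
Local Notation "u ** v" := (mul L u v) (at level 40).
Implicit Types a b c u v w z t : L.

Lemma mul_opp u v : u ** v = - (v ** u).
Proof.
apply/eqP; rewrite -addr_eq0; apply/eqP.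
have := mul_alt (u + v).
by rewrite linearDl /= !linearDr /= !mul_alt add0r addr0.
Qed.

Lemma phi_rot u v w : phi u v w = phi v w u.
Proof. exact: form_mul. Qed.

Lemma phi_swap u v w : phi u v w = - phi v u w.
Proof. by rewrite /phi mul_opp linearNl. Qed.

Lemma phi_alt12 u v : phi u u v = 0.
Proof. by rewrite /phi mul_alt linear0l. Qed.

Lemma phiD1 u u' v w : phi (u + u') v w = phi u v w + phi u' v w.
Proof. by rewrite /phi !linearDl. Qed.

Lemma phiZ1 k u v w : phi (k *: u) v w = k * phi u v w.
Proof. by rewrite /phi !linearZl_LR. Qed.

Lemma phiD2 u v v' w : phi u (v + v') w = phi u v w + phi u v' w.
Proof. by rewrite /phi linearDr linearDl. Qed.

Lemma phiZ2 k u v w : phi u (k *: v) w = k * phi u v w.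
Proof. by rewrite /phi linearZr_LR linearZl_LR. Qed.

Lemma phiD3 u v w w' : phi u v (w + w') = phi u v w + phi u v w'.
Proof. by rewrite /phi linearDr. Qed.

Lemma phiZ3 k u v w : phi u v (k *: w) = k * phi u v w.
Proof. by rewrite /phi linearZr_LR. Qed.

Definition phi_lin := (phiD1, phiZ1, phiD2, phiZ2, phiD3, phiZ3).

(** Non-degeneracy makes a |-> (a, _) injective from L to its dual, which has
    the same dimension. *)
Lemma form_represents (f : 'Hom(L, F^o)) : exists a, forall v, <|a, v|> = f v.
Proof.
have lin : linear (fun a : L => linfun (form L a : L -> F^o)).
  move=> k u v; apply/lfunP=> y; rewrite add_lfunE scale_lfunE !lfunE /=.
  by rewrite linearPl.
pose h := HB.pack_for {linear L -> 'Hom(L, F^o)} (fun a : L =>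
  linfun (form L a : L -> F^o))
  (GRing.isLinear.Build _ _ _ _ _ lin).
have ker0 : lker (linfun h) == 0%VS.
  rewrite -subv0; apply/subvP=> a; rewrite memv_ker lfunE /= memv0 => /eqP h0.
  apply/eqP/form_nondeg => v.
  by have := congr1 (fun g : 'Hom(L, F^o) => g v) h0; rewrite lfunE zero_lfunE.
have full : (limg (linfun h) == fullv)%VS.
  rewrite eqEdim subvf /= limg_dim_eq ?(eqP ker0) ?capv0 //.
  by rewrite !dimvf /dim /= /dim /= muln1.
have /memv_imgP[a _ fa] : f \in limg (linfun h) by rewrite (eqP full) memvf.
by exists a => v; rewrite fa lfunE /= lfunE.
Qed.

(** The i-th coordinate of the projection onto <<s>> along W is a linear form,
    and every linear form is of the form (a, _). *)
Lemma dual_family n (s : n.-tuple L) (W : {vspace L}) :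
  free s -> (<<s>> :&: W = 0)%VS ->
  exists a : 'I_n -> L,
    (forall i w, w \in W -> <|a i, w|> = 0) /\
    (forall i j : 'I_n, <|a i, s`_j|> = (i == j)%:R).
Proof.
move=> fs sW.
have /fin_all_exists[a aP] i : exists a, forall v,
   <|a, v|> = (linfun (coord s i : L -> F^o) \o daddv_pi <<s>> W)%VF v.
  exact: form_represents.
exists a; split=> [i w wW | i j]; rewrite aP comp_lfunE lfunE /=.
  have := daddv_pi_add sW (subvP (addvSr <<s>> W) w wW).
  rewrite (@daddv_pi_id _ _ W) // 1?capvC // => /(canRL (addrK w)) ->.
  by rewrite subrr linear0.
rewrite daddv_pi_id ?coord_free 1?eq_sym //.
by rewrite memv_span // mem_nth ?size_tuple.
Qed.

Lemma cap_vline (W : {vspace L}) v : v \notin W -> (<[v]> :&: W = 0)%VS.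
Proof.
move=> vW; apply/eqP; rewrite -subv0; apply/subvP=> w.
rewrite memv_cap => /andP[/vlineP[k ->]]; have [->|k0] := eqVneq k 0.
  by move=> _; rewrite scale0r mem0v.
by move=> kvW; case/negP: vW; rewrite -[v](scalerK k0) memvZ.
Qed.

Lemma dim_add_vline (W : {vspace L}) v : v \notin W ->
  (\dim (W + <[v]>) = (\dim W).+1)%N.
Proof.
move=> vW; rewrite dimv_disjoint_sum ?dim_vline 1?capvC ?cap_vline //.
by rewrite eq_sym (memPn vW) ?addn1 ?mem0v.
Qed.

Lemma separate (W : {vspace L}) u : u \notin W ->
  exists2 a, forall w, w \in W -> <|a, w|> = 0 & <|a, u|> = 1.
Proof.
move=> uW.
have u0 : u != 0 by apply: contraNneq uW => ->; rewrite mem0v.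
have [||a [aW au]] := @dual_family 1 [tuple u] W.
- by rewrite seq1_free.
- by rewrite span_seq1 cap_vline.
by exists (a ord0); [exact: aW | rewrite (au ord0 ord0) eqxx].
Qed.

Lemma indep_mod n (s : n.-tuple L) (W : {vspace L}) :
  (forall k : 'I_n -> F, \sum_(i < n) k i *: s`_i \in W -> forall i, k i = 0) ->
  free s /\ (<<s>> :&: W = 0)%VS.
Proof.
move=> h; split; first by apply/freeP=> k k0; apply: h; rewrite k0 mem0v.
apply/eqP; rewrite -subv0; apply/subvP=> v; rewrite memv_cap => /andP[vs vW].
rewrite memv0 (coord_span vs) big1 // => i _.
by rewrite (h (fun i => coord s i v)) ?scale0r // -(coord_span vs).
Qed.

Lemma prod_in_lpow2 u v : u ** v \in lpow L 2.
Proof. by apply: (prod_vsP _ _ _ (subvv (lpow L 2))); rewrite ?memvf. Qed.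

Lemma phi_center0 c u v : c \in center L -> phi c u v = 0.
Proof. by move=> /memv_center cZ; rewrite /phi cZ linear0l. Qed.

(** By rotation, (ab, c) = (ca, b), and this is 0 for c central. *)
Lemma center_perp c u : c \in center L -> u \in lpow L 2 -> <|c, u|> = 0.
Proof.
move=> cZ; apply: (@span_ind _ _ (fun u => <|c, u|> = 0)) =>
  [|k u' v hu hv|_ /allpairsP[[a b] /= [_ _ ->]]].
- exact: linear0r.
- by rewrite linearPr /= hu hv mulr0 addr0.
by rewrite form_opp -/(phi a b c) -phi_rot phi_center0 // oppr0.
Qed.

Lemma perp_lpow2 a :
  (forall w, w \in lpow L 2 -> <|a, w|> = 0) -> a \in center L.
Proof.
move=> aW; apply/memv_center=> y; apply: form_nondeg => v.
by rewrite form_mul form_opp aW ?oppr0 // prod_in_lpow2.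
Qed.

(** A vector outside L^2 is detected by some a orthogonal to L^2, and such an
    a is central. *)
Lemma perp_center u :
  (forall c, c \in center L -> <|c, u|> = 0) -> u \in lpow L 2.
Proof.
move=> uZ; apply/negPn/negP=> /separate[a /perp_lpow2/uZ ->].
by move/eqP; rewrite eq_sym oner_eq0.
Qed.

(** A family d dual to a basis of the center spans a complement of L^2: the
    vector u - sum_i (u, c_i) d_i is orthogonal to the basis c of the center.
    *)
Lemma dim_lpow2_center : (\dim (lpow L 2) + \dim (center L) = \dim {:L})%N.
Proof.
have [||d [_ dc]] := @dual_family _ (vbasis (center L)) 0%VS.
- exact: basis_free (vbasisP _).
- exact: capv0.
have dform (k : 'I_(\dim (center L)) -> F) (j : 'I_(\dim (center L))) :
    <|\sum_i k i *: d i, (vbasis (center L))`_j|> = k j.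
  rewrite linear_sumlz (bigD1 j) //= linearZl_LR /= dc eqxx mulr1.
  rewrite big1 ?addr0 // => i ij.
  by rewrite linearZl_LR /= dc (negPf ij) mulr0.
have [|fD DW] := @indep_mod _ (mktuple d) (lpow L 2).
  move=> k; under eq_bigr do rewrite -(tnth_nth 0) tnth_mktuple.
  move=> kW j; rewrite -(dform k j) form_opp center_perp ?oppr0 //.
  by apply: vbasis_mem; rewrite mem_nth ?size_tuple.
rewrite addnC -[X in (X + _)%N](size_tuple (mktuple d)) -(eqP fD).
rewrite -dimv_disjoint_sum //; congr (\dim _); apply/vspaceP=> u.
rewrite memvf -[u](subrK (\sum_(i < \dim (center L)) <|u,
  (vbasis (center L))`_i|> *: d i)) addrC.
rewrite memv_add //.
  apply: memv_suml => i _; apply: memvZ; apply: memv_span.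
  by apply: map_f; rewrite mem_enum.
apply: perp_center => c /coord_vbasis ->.
rewrite linear_sumlz big1 // => j _.
by rewrite linearZl_LR /= form_opp linearBl /= dform subrr oppr0 mulr0.
Qed.

(** * Annihilators of elements of L^2 *)

Section L3.
Hypothesis L3Z : lpow L 3 = center L.

Lemma mul_lpow2 a b : a \in lpow L 2 -> a ** b \in center L.
Proof.
by move=> a2; rewrite -L3Z; apply: (prod_vsP _ _ _ (subvv (lpow L 3)));
   rewrite ?memvf.
Qed.

Lemma lpow2_abelian a b : a \in lpow L 2 -> b \in lpow L 2 -> a ** b = 0.
Proof.
move=> a2 b2; apply: form_nondeg => w.
by rewrite -/(phi a b w) -phi_rot phi_swap /phi center_perp ?oppr0 ?mul_lpow2.
Qed.

Lemma center_sub_lpow2 c : c \in center L -> c \in lpow L 2.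
Proof.
rewrite -L3Z; apply: subvP; apply/prod_vsP => u v _ _; exact: prod_in_lpow2.
Qed.

Definition annihilator (z : L) : {vspace L} := lker (linfun (mul L z)).

Lemma annihilatorP z u : reflect (z ** u = 0) (u \in annihilator z).
Proof. by rewrite memv_ker lfunE; apply: eqP. Qed.

(** An element killed by z and t is killed by L^2 = <z, t> + Z, so it is
    orthogonal to L^3, which is the center. *)
Lemma annihilatorI z t : basis_mod (lpow L 2) (center L) [:: z; t] ->
  (annihilator z :&: annihilator t <= lpow L 2)%VS.
Proof.
case=> _ _ L2E; apply/subvP=> u; rewrite memv_cap =>
  /andP[/annihilatorP zu /annihilatorP tu].
apply: perp_center => c; rewrite -L3Z.
apply: (@span_ind _ _ (fun c => <|c, u|> = 0)) => [|k c' c'' h h'|].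
- exact: linear0l.
- by rewrite linearPl /= h h' mulr0 addr0.
move=> _ /allpairsP[[a b] /= [a2 _ ->]].
move: (vbasis_mem a2); rewrite -[prod_vs _ _]/(lpow L 2) -L2E span_cons
  span_seq1.
case/memv_addP=> _ /memv_addP[_ /vlineP[k ->] [_ /vlineP[l ->] ->]] [c' cZ ->].
rewrite -/(phi _ b u) !phi_lin [phi c' _ _]phi_center0 // -![phi _ b u]phi_rot.
by rewrite !(phi_swap u) /phi zu tu linear0l; ring.
Qed.

Lemma phi_eq1 z a : z ** a != 0 -> exists b, phi z a b = 1.
Proof.
move=> za; have : linfun (form L (z ** a) : L -> F^o) != 0.
  apply: contraNneq za => h; apply/eqP/form_nondeg => v.
  by have := congr1 (fun g : 'Hom(L, F^o) => g v) h; rewrite lfunE zero_lfunE.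
case/lfunPn=> b; rewrite zero_lfunE lfunE /= => nz.
by exists ((phi z a b)^-1 *: b); rewrite phiZ3 mulVf.
Qed.

(** The form phi z is nonzero, so phi z a b = 1 for some a and b, and it has u
    in its radical; the rank of an alternating form is even, so on the
    4-dimensional space L / L^2 the radical contains a second direction. It is
    obtained concretely: any w0 outside L^2 + <u, a, b>, once made orthogonal
    to a and b for phi z, is also orthogonal to u, to itself and to L^2, thus
    to L. *)
Lemma dim_annihilator_ge z u : (\dim (lpow L 2) + 4 = \dim {:L})%N ->
  z \in lpow L 2 -> z \notin center L -> u \notin lpow L 2 -> z ** u = 0 ->
  (\dim (lpow L 2) + 2 <= \dim (annihilator z))%N.
Proof.
move=> dimL z2 zZ u2 zu.
have [a za] : exists a, z ** a != 0.
  have [h | /lfunPn[a]] := eqVneq (linfun (mul L z)) 0; last first.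
    by rewrite lfunE zero_lfunE; exists a.
  case/negP: zZ; apply/memv_center=> y.
  by have := congr1 (fun g : 'Hom(L, L) => g y) h; rewrite lfunE zero_lfunE.
have [b zab] := phi_eq1 za.
have zL2 v l : l \in lpow L 2 -> phi z v l = 0.
  by move=> l2; rewrite -phi_rot phi_swap /phi lpow2_abelian // linear0l oppr0.
have zu' v : phi z v u = 0 by rewrite -phi_rot phi_swap /phi zu linear0l oppr0.
have zaa v : phi z v v = 0 by rewrite phi_rot phi_alt12.
have zba : phi z b a = -1 by rewrite phi_rot phi_swap phi_rot phi_rot zab.
pose X0 := (lpow L 2 + <[u]>)%VS.
have zX0 v x : x \in X0 -> phi z v x = 0.
  case/memv_addP=> l l2 [_ /vlineP[k ->] ->].
  by rewrite phiD3 phiZ3 zL2 // zu' mulr0 addr0.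
have aX0 : a \notin X0 by apply/negP=> /(zX0 b)/eqP;
  rewrite zba oppr_eq0 oner_eq0.
have bX1 : b \notin (X0 + <[a]>)%VS.
  apply/memv_addP=> -[x /(zX0 a) zx [_ /vlineP[k ->] bE]]; move/eqP: zab.
  by rewrite bE phiD3 phiZ3 zx zaa mulr0 addr0 eq_sym oner_eq0.
pose X := (X0 + <[a]> + <[b]>)%VS.
have dimX : (\dim X = \dim (lpow L 2) + 3)%N.
  by rewrite !dim_add_vline // !addnS addn0.
have /subvPn[w0 _ w0X] : ~~ (fullv <= X)%VS.
  by apply/negP=> /dimvS; rewrite dimX -dimL leq_add2l.
have aX : a \in X by rewrite (subvP (addvSl _ _)) // (subvP (addvSr _ _)) //
  memv_line.
have bX : b \in X by rewrite (subvP (addvSr _ _)) // memv_line.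
(* the component of w0 that is orthogonal to a and b for phi z *)
pose w := w0 + (- phi z w0 b *: a + phi z w0 a *: b).
have wX : w \notin X by rewrite rpredDr ?memvD ?memvZ.
have zw : z ** w = 0.
  apply: form_nondeg => v; rewrite -/(phi z w v).
  have : v \in (X + <[w]>)%VS.
    suff -> : (X + <[w]>)%VS = fullv by rewrite memvf.
    by apply/eqP; rewrite eqEdim subvf dim_add_vline // dimX -dimL -addnS leqnn.
  case/memv_addP=> _ /memv_addP[_ /memv_addP[x /(zX0 w) xz
    [_ /vlineP[k ->] ->]] [_ /vlineP[l ->] ->]] [_ /vlineP[m ->] ->].
  by rewrite !phiD3 !phiZ3 xz zaa /w !phi_lin !zaa zba zab; ring.
have wX0 : w \notin X0.
  by apply: contra wX => wX0; rewrite /X -addvA (subvP (addvSl _ _)).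
rewrite addn2 -(dim_add_vline u2) -(dim_add_vline wX0); apply: dimvS.
apply/subvP=> _ /memv_addP[_ /memv_addP[l l2 [_ /vlineP[k ->] ->]]
  [_ /vlineP[m ->] ->]]; apply/annihilatorP.
by rewrite !linearDr !linearZr_LR /= zu zw lpow2_abelian // !scaler0 !addr0.
Qed.

(** Since the annihilators of z and t together span L, the vector that pairs
    with u under phi z can be taken in the annihilator of t. *)
Lemma complementary_pair z t : (\dim (lpow L 2) + 4 = \dim {:L})%N ->
  basis_mod (lpow L 2) (center L) [:: z; t] ->
  z \in lpow L 2 -> t \in lpow L 2 ->
  z \notin center L -> t \notin center L ->
  degenerate_mod (lpow L 2) (phi z) -> degenerate_mod (lpow L 2) (phi t) ->
  exists u v, [/\ t ** u = 0, t ** v = 0 & phi z u v = 1].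
Proof.
move=> dimL zt z2 t2 zZ tZ [u1 u12 /form_nondeg zu1] [u u2 /form_nondeg tu].
have zu : z ** u != 0.
  by apply: contra u2 => /eqP/annihilatorP zu;
    rewrite (subvP (annihilatorI zt)) // memv_cap zu; apply/annihilatorP.
have [b zub] := phi_eq1 zu.
have : b \in (annihilator z + annihilator t)%VS.
  suff -> : (annihilator z + annihilator t = fullv)%VS by rewrite memvf.
  apply/eqP; rewrite eqEdim subvf -(leq_add2r (\dim (annihilator z :&:
    annihilator t))).
  rewrite dimv_sum_cap; apply: leq_trans (leq_add (dim_annihilator_ge _ z2 zZ
    u12 _) (dim_annihilator_ge _ t2 tZ u2 _)) => //.
  rewrite -dimL; apply: leq_trans (leq_add (leqnn _) (dimvS (annihilatorI zt)))
    _.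
  by rewrite [X in (_ <= X)%N]addnACA [X in (X <= _)%N]addnAC.
case/memv_addP=> b1 /annihilatorP zb1 [b2 /annihilatorP tb2 bE].
exists u, b2; split=> //; move: zub; rewrite bE phiD3.
by rewrite -phi_rot phi_swap /phi zb1 linear0l oppr0 add0r.
Qed.

End L3.

(** The pairing (z, t) is not zero, as otherwise z would be orthogonal to <z,
    t> + Z = L^2, hence central; dividing t by it forces y5 to be multiplied
    by it. *)
Lemma hyperbolic_frame : saa_10_4 L -> type_A L ->
  exists z t y2 y3 y4 y5 : L,
    [/\ z \in lpow L 2, t \in lpow L 2 & <|z, t|> = 1] /\
    [/\ t ** y2 = 0, t ** y3 = 0 & phi z y2 y3 = 1] /\
    [/\ z ** y4 = 0, z ** y5 = 0 & phi t y4 y5 = 1].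
Proof.
case=> _ dim10 _ dimZ L3Z [z [t [zt degz degt]]].
have dimL : (\dim (lpow L 2) + 4 = \dim {:L})%N.
  by rewrite -dim_lpow2_center dimZ.
have tz : basis_mod (lpow L 2) (center L) [:: t; z].
  have zt_perm : perm_eq [:: t; z] [:: z; t].
    exact: (permEl (perm_catC [:: t] [:: z])).
  case: zt => fr dis sum; split; rewrite ?(perm_free zt_perm) //.
    by rewrite (eq_span (perm_mem zt_perm)).
  by rewrite (eq_span (perm_mem zt_perm)).
have in_lpow2 z' t' : basis_mod (lpow L 2) (center L) [:: z'; t'] ->
    z' \in lpow L 2 /\ z' \notin center L.
  case=> fr dis <-; have zs : z' \in <<[:: z'; t']>>%VS.
    by rewrite memv_span ?mem_head.
  split; first by rewrite (subvP (addvSl _ _)).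
  apply/negP=> zZ; have : z' \in (<<[:: z'; t']>> :&: center L)%VS
    by rewrite memv_cap zs.
  rewrite dis memv0 => /eqP z0; move: fr; rewrite z0 free_cons mem0v //.
have [z2 zZ] := in_lpow2 _ _ zt; have [t2 tZ] := in_lpow2 _ _ tz.
have [y2 [y3 [ty2 ty3 zyy]]] := complementary_pair L3Z dimL zt z2 t2 zZ tZ degz
  degt.
have [y4 [y5 [zy4 zy5 tyy]]] := complementary_pair L3Z dimL tz t2 z2 tZ zZ degt
  degz.
have zt0 : <|z, t|> != 0.
  apply: contraNneq zZ => zt0; apply: perp_lpow2 => w; case: zt => _ _ <-.
  rewrite span_cons span_seq1.
  case/memv_addP=> _ /memv_addP[_ /vlineP[k ->] [_ /vlineP[l ->] ->]] [c cZ ->].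
  rewrite !linearDr !linearZr_LR /= form_alt zt0 !mulr0 !add0r form_opp.
  by rewrite center_perp ?oppr0.
pose k := <|z, t|>; exists z, (k^-1 *: t), y2, y3, y4, (k *: y5).
split; first by split; rewrite ?memvZ // linearZr_LR /= mulVf.
split; split; rewrite ?linearZl_LR ?linearZr_LR /= ?ty2 ?ty3 ?zy5 ?scaler0 //.
by rewrite phiZ1 phiZ3 tyy mulr1 mulVf.
Qed.

(** The correction of y4 by a multiple of z changes phi y2 y3 y4 by that
    multiple, because phi y2 y3 z = 1, and symmetrically for the others. The
    corrections do not interfere: t annihilates y2 and y3, and z annihilates
    y4 and y5, so the products y2 y3 and y4 y5 do not change, and neither do
    the values of z and t since zt = 0. *)
Lemma adapted_frame : saa_10_4 L -> type_A L ->
  exists z t y2 y3 y4 y5 : L,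
    [/\ z \in lpow L 2, t \in lpow L 2 & <|z, t|> = 1] /\
    [/\ t ** y2 = 0, t ** y3 = 0 & phi z y2 y3 = 1] /\
    [/\ z ** y4 = 0, z ** y5 = 0 & phi t y4 y5 = 1] /\
    [/\ phi y2 y3 y4 = 0, phi y2 y3 y5 = 0, phi y4 y5 y2 = 0
      & phi y4 y5 y3 = 0].
Proof.
move=> L10 tA; have [z [t [y2 [y3 [y4 [y5]]]]]] := hyperbolic_frame L10 tA.
case=> -[z2 t2 zt] [[ty2 ty3 zyy] [zy4 zy5 tyy]].
have L3Z : lpow L 3 = center L by case: L10.
have zt0 : z ** t = 0 by exact: lpow2_abelian.
have tz0 : t ** z = 0 by exact: lpow2_abelian.
have sub u v a k : u ** v = 0 -> u ** a = 0 -> u ** (v + k *: a) = 0.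
  by move=> uv ua; rewrite linearDr linearZr_LR /= uv ua scaler0 addr0.
have subl u v a k l : a ** u = 0 -> a ** v = 0 ->
    (u + k *: a) ** (v + l *: a) = u ** v.
  move=> au av; rewrite linearDl !linearDr !linearZr_LR !linearZl_LR /=.
  by rewrite av mul_alt [u ** a]mul_opp au oppr0 !scaler0 !addr0.
exists z, t, (y2 + - phi y4 y5 y2 *: t), (y3 + - phi y4 y5 y3 *: t),
  (y4 + - phi y2 y3 y4 *: z), (y5 + - phi y2 y3 y5 *: z).
split=> //.
have zyy' : phi y2 y3 z = 1 by rewrite phi_rot phi_rot.
have tyy' : phi y4 y5 t = 1 by rewrite phi_rot phi_rot.
split; last split; split; rewrite ?sub ?mul_alt //.
- by rewrite phi_rot /phi subl.
- by rewrite phi_rot /phi subl.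
- by rewrite /phi subl // -/(phi _ _ _) !phi_lin zyy' mulr1 subrr.
- by rewrite /phi subl // -/(phi _ _ _) !phi_lin zyy' mulr1 subrr.
- by rewrite /phi subl // -/(phi _ _ _) !phi_lin tyy' mulr1 subrr.
- by rewrite /phi subl // -/(phi _ _ _) !phi_lin tyy' mulr1 subrr.
Qed.

(** The pairings with the family itself recover the coefficients of a linear
    relation, so only the dimension is left to compare. *)
Lemma standard_basis_of_form n (e : 'I_n + 'I_n -> L) :
  \dim {:L} = (n + n)%N ->
  (forall i j, <|e (inl i), e (inl j)|> = 0) ->
  (forall i j, <|e (inr i), e (inr j)|> = 0) ->
  (forall i j, <|e (inl i), e (inr j)|> = (i == j)%:R) -> standard_basis e.
Proof.
move=> dimL xx yy xy; split=> //.
rewrite basisEfree subvf size_codom card_sum !card_ord dimL leqnn !andbT.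
apply/(@freeP _ _ _ (codom_tuple e)) => k k0.
have {}k0 : \sum_c k (enum_rank c) *: e c = 0.
  transitivity (\sum_(c in {: 'I_n + 'I_n}) k (enum_rank c) *: e c).
    exact: eq_bigl.
  rewrite -[RHS]k0 big_enum_val.
  apply: eq_bigr => i _; rewrite enum_valK; congr (_ *: _).
  by rewrite nth_codom.
have kx i : k (enum_rank (inl i)) = 0.
  have := congr1 (fun v => <|v, e (inr i)|>) k0.
  rewrite linear0l linear_sumlz big_sumType /= (bigD1 i) //= !linearZl_LR /= xy
    eqxx mulr1.
  rewrite big1 ?addr0 => [|j ij]; last by rewrite linearZl_LR /= xy (negPf ij)
    mulr0.
  by rewrite big1 ?addr0 // => j _; rewrite linearZl_LR /= yy mulr0.
have ky i : k (enum_rank (inr i)) = 0.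
  have := congr1 (fun v => <|e (inl i), v|>) k0.
  rewrite linear0r linear_sumr big_sumType /= addrC (bigD1 i) //= !linearZr_LR
    /= xy eqxx mulr1.
  rewrite big1 ?addr0 => [|j ij]; last by rewrite linearZr_LR /= xy eq_sym
    (negPf ij) mulr0.
  by rewrite big1 ?addr0 // => j _; rewrite linearZr_LR /= xx mulr0.
by move=> i; rewrite -[i]enum_valK; case: (enum_val i).
Qed.

Lemma mul_mod_center u u' v v' :
  u' - u \in center L -> v' - v \in center L -> u' ** v' = u ** v.
Proof.
move=> /memv_center uZ /memv_center vZ.
rewrite -[u'](subrK u) -[v'](subrK v) linearDl /= uZ add0r linearDr /=.
by rewrite [u ** _]mul_opp vZ oppr0 add0r.
Qed.

Lemma phi_mod_center u u' v v' w w' :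
  u' - u \in center L -> v' - v \in center L -> w' - w \in center L ->
  phi u' v' w' = phi u v w.
Proof.
move=> uZ vZ wZ; rewrite /phi (mul_mod_center uZ vZ) -/(phi u v w') phi_rot.
by rewrite /phi (@mul_mod_center v v w w') ?subrr ?mem0v // -/(phi v w u)
  -phi_rot.
Qed.

(** The strictly upper triangular part of the Gram matrix of s gives the
    correction: s_j becomes s_j + sum_(k < j) (s_k, s_j) a_k. For i < j this
    changes (s_i, s_j) only through the term in a_i, and halving is avoided,
    so the characteristic may be 2. *)
Lemma isotropic_lift n (U : {vspace L}) (a s : 'I_n -> L) :
  isotropic U -> (forall i, a i \in U) ->
  (forall i j, <|a i, s j|> = (i == j)%:R) ->
  exists s' : 'I_n -> L,
    (forall j, s' j - s j \in U) /\ (forall i j, <|s' i, s' j|> = 0).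
Proof.
move=> isoU aU as1.
pose c (j : 'I_n) := \sum_(k < n | (k < j)%N) <|s k, s j|> *: a k.
have cU j : c j \in U by apply: memv_suml => k _; rewrite memvZ.
have cs (i j : 'I_n) : <|c j, s i|> = if (i < j)%N then <|s i, s j|> else 0.
  rewrite linear_sumlz; case: ifP => ij.
    rewrite (bigD1 i) //= linearZl_LR /= as1 eqxx mulr1 big1 ?addr0 // =>
      k /andP[_ ki].
    by rewrite linearZl_LR /= as1 (negPf ki) mulr0.
  rewrite big1 // => k kj; rewrite linearZl_LR /= as1.
  by case: eqP kj => [->|]; rewrite ?ij ?mulr0.
exists (fun j => s j + c j); split=> [j|i j]; first by rewrite addrC addKr.
wlog ij : i j / (i < j)%N => [hw|].
  case: (ltngtP i j) => [/hw//|/hw ji|/ord_inj ->]; last exact: form_alt.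
  by rewrite form_opp ji oppr0.
rewrite linearDl /= !linearDr /= [<|c i, c j|>]isoU // cs.
rewrite [<|s i, c j|>]form_opp cs.
by rewrite ij ltnNge (ltnW ij) /= addr0 addr0 subrr.
Qed.

Lemma phi_perm_eq0 u v w : phi u v w = 0 ->
  (phi u v w = 0) * (phi v w u = 0) * (phi w u v = 0) *
  (phi v u w = 0) * (phi u w v = 0) * (phi w v u = 0).
Proof.
move=> h.
have h1 : phi v w u = 0 by rewrite -phi_rot.
have h2 : phi w u v = 0 by rewrite phi_rot.
by do !split; rewrite // phi_swap ?h ?h1 ?h2 oppr0.
Qed.

(** Once the central x2, ..., x5 and the products equal to 0 are set aside, a
    triple of distinct basis vectors is a reordering of one of the six triples
    whose value is prescribed. *)
Lemma given_by_P10 (e : 'I_5 + 'I_5 -> L) :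
  standard_basis e -> (forall j, e (inl (lift ord0 j)) \in center L) ->
  e 'x_1 ** e 'y_1 = 0 ->
  [/\ e 'y_1 ** e 'y_2 = 0, e 'y_1 ** e 'y_3 = 0
    & phi (e 'x_1) (e 'y_2) (e 'y_3) = 1] ->
  [/\ e 'x_1 ** e 'y_4 = 0, e 'x_1 ** e 'y_5 = 0
    & phi (e 'y_1) (e 'y_4) (e 'y_5) = 1] ->
  [/\ phi (e 'y_2) (e 'y_3) (e 'y_4) = 0, phi (e 'y_2) (e 'y_3) (e 'y_5) = 0,
      phi (e 'y_4) (e 'y_5) (e 'y_2) = 0
    & phi (e 'y_4) (e 'y_5) (e 'y_3) = 0] ->
  given_by L (P10_4_2 F).
Proof.
move=> sb eZ x1y1 [y1y2 y1y3 x1y2y3] [x1y4 x1y5 y1y4y5] [y234 y235 y452 y453].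
exists e; split=> //.
  move=> a b c r; rewrite !inE => /orP[] /eqP[-> -> -> ->].
    exact: x1y2y3.
  exact: y1y4y5.
have T1 u v w : u \in center L -> phi u v w = 0 by exact: phi_center0.
have T2 u v w : v \in center L -> phi u v w = 0.
  by move=> vZ; rewrite phi_rot T1.
have T3 u v w : w \in center L -> phi u v w = 0.
  by move=> wZ; rewrite -phi_rot T1.
move=> a b c nl; rewrite -/(phi _ _ _).
have n1 : ~~ perm_eq [:: a; b; c] [:: 'x_1; 'y_2; 'y_3].
  by apply: (nl _ _ _ 1); rewrite !inE eqxx.
have n2 : ~~ perm_eq [:: a; b; c] [:: 'y_1; 'y_4; 'y_5].
  by apply: (nl _ _ _ 1); rewrite !inE eqxx orbT.
have p0 u v w : u ** v = 0 ->
    (phi u v w = 0) * (phi v w u = 0) * (phi w u v = 0) *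
    (phi v u w = 0) * (phi u w v = 0) * (phi w v u = 0).
  move=> uv; have h : phi u v w = 0 by rewrite /phi uv linear0l.
  exact: phi_perm_eq0.
have {}eZ (j : nat) (j5 : (j.+1 < 5)%N) :
    e (inl (@Ordinal 5 j.+1 j5)) \in center L.
  by rewrite (_ : Ordinal j5 = lift ord0 (@Ordinal 4 j j5)) ?eZ //;
    apply: val_inj.
have pz := (fun w => p0 _ _ w x1y1, fun w => p0 _ _ w x1y4,
  fun w => p0 _ _ w x1y5, fun w => p0 _ _ w y1y2, fun w => p0 _ _ w y1y3,
  fun u w => p0 _ _ w (mul_alt u)).
have yz := (phi_perm_eq0 y234, phi_perm_eq0 y235, phi_perm_eq0 y452,
  phi_perm_eq0 y453).
by clear nl; case: a n1 n2; elim/ord5_ind; rewrite ?(T1 _ _ _ (eZ _ _)) //;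
  case: b; elim/ord5_ind; rewrite ?(T2 _ _ _ (eZ _ _)) ?pz //;
  case: c; elim/ord5_ind; rewrite ?(T3 _ _ _ (eZ _ _)) ?pz ?yz.
Qed.

(** The y_i are independent modulo L^2, because phi z and phi t evaluated
    against them read off the coefficients; this yields the central family a
    dual to them. The central corrections come in this order: the y_i are made
    orthogonal to one another first, then z and t are made orthogonal to the
    new y_i. *)
Lemma type_A_given_by : saa_10_4 L -> type_A L -> given_by L (P10_4_2 F).
Proof.
move=> L10 tA; have [z [t [y2 [y3 [y4 [y5]]]]]] := adapted_frame L10 tA.
case=> -[z2 t2 zt] [[ty2 ty3 zyy] [[zy4 zy5 tyy] [y234 y235 y452 y453]]].
have [_ dim10 isoZ _ L3Z] := L10.
have zt0 : z ** t = 0 by exact: lpow2_abelian.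
pose s := [tuple y2; y3; y4; y5].
have [|fs sW] := @indep_mod _ s (lpow L 2).
  move=> k; rewrite !big_ord_recl big_ord0 /= addr0.
  set v := (X in X \in _) => v2.
  have phi0 w x : w \in lpow L 2 -> phi w v x = 0.
    by move=> w2; rewrite /phi lpow2_abelian // linear0l.
  have alt u w : phi u w w = 0 by rewrite phi_rot phi_alt12.
  have zz w : (phi z y4 w = 0) * (phi z y5 w = 0)
    by rewrite /phi zy4 zy5 !linear0l.
  have tt w : (phi t y2 w = 0) * (phi t y3 w = 0)
    by rewrite /phi ty2 ty3 !linear0l.
  have zyy' : phi z y3 y2 = -1 by rewrite phi_rot phi_swap phi_rot phi_rot zyy.
  have tyy' : phi t y5 y4 = -1 by rewrite phi_rot phi_swap phi_rot phi_rot tyy.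
  have := phi0 t y4 t2; have := phi0 t y5 t2; have := phi0 z y2 z2;
    have := phi0 z y3 z2.
  rewrite /v !phi_lin !(zz, tt, alt, zyy, zyy', tyy, tyy', mulr0, mulr1,
    mulrN1, add0r, addr0).
  move=> k0 /eqP + k2 /eqP; rewrite !oppr_eq0 => /eqP k1 /eqP k3.
  by case=> [[|[|[|[|//]]]] i4]; [move: k0 | move: k1 | move: k2 | move: k3];
    move=> <-; congr k; apply: val_inj.
(* a = (x2, ..., x5) *)
have [a [aL2 as1]] := dual_family fs sW.
have aZ i : a i \in center L by apply: perp_lpow2; exact: aL2.
have [Y [YZ YY]] := isotropic_lift (s := fun i => s`_i) isoZ aZ as1.
have aY i j : <|a i, Y j|> = (i == j)%:R.
  by rewrite -as1; apply/eqP; rewrite -subr_eq0 -linearBr /= isoZ.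
have corr w : w \in lpow L 2 -> exists w', [/\ w' - w \in center L,
    w' \in lpow L 2 & forall j, <|w', Y j|> = 0].
  move=> w2; pose c := \sum_i <|w, Y i|> *: a i.
  have cZ : c \in center L by apply: memv_suml => i _; rewrite memvZ.
  exists (w - c); split.
  - by rewrite addrAC subrr sub0r memvN.
  - by rewrite memvB // center_sub_lpow2.
  move=> j; rewrite linearBl linear_sumlz /= (bigD1 j) //= linearZl_LR /= aY
    eqxx mulr1.
  rewrite big1 ?addr0 ?subrr // => i ij.
  by rewrite linearZl_LR /= aY (negPf ij) mulr0.
have [z' [z'Z z'2 z'Y]] := corr z z2; have [t' [t'Z t'2 t'Y]] := corr t t2.
have zt' : <|z', t'|> = 1.
  rewrite -zt -[z'](subrK z) linearDl /= center_perp // add0r.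
  by rewrite -[t'](subrK t) linearDr /= form_opp center_perp // oppr0 add0r.
pose e (c : 'I_5 + 'I_5) : L := match c with
  | inl i => oapp a z' (unlift ord0 i) | inr i => oapp Y t' (unlift ord0 i) end.
have sb : standard_basis e.
  apply: standard_basis_of_form; rewrite ?dim10 // => i j; rewrite /e.
  - case: (unliftP ord0 i) => [i'|] _; case: (unliftP ord0 j) => [j'|] _ /=.
    + exact: isoZ.
    + exact: center_perp.
    + by rewrite form_opp center_perp ?oppr0.
    + exact: form_alt.
  - case: (unliftP ord0 i) => [i'|] _; case: (unliftP ord0 j) => [j'|] _ //=.
    + by rewrite form_opp t'Y oppr0.
    + exact: form_alt.
  case: (unliftP ord0 i) => [i'|] ->; case: (unliftP ord0 j) => [j'|] -> //=.
  by rewrite center_perp.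
have xL j : e (inl (lift ord0 j)) = a j by rewrite /e liftK.
have yL j : e (inr (lift ord0 j)) = Y j by rewrite /e liftK.
have eyZ (j : nat) (j4 : (j < 4)%N) (j5 : (j.+1 < 5)%N) :
    e (inr (@Ordinal 5 j.+1 j5)) - s`_j \in center L.
  rewrite (_ : Ordinal j5 = lift ord0 (@Ordinal 4 j j4)) ?yL;
    last exact: val_inj.
  exact: (YZ (Ordinal j4)).
have ez : e 'x_1 = z' by rewrite /e (_ : Ordinal _ = ord0) ?unlift_none //;
  apply: val_inj.
have et : e 'y_1 = t' by rewrite /e (_ : Ordinal _ = ord0) ?unlift_none //;
  apply: val_inj.
have e2 := eyZ 0%N isT isT; have e3 := eyZ 1%N isT isT.
have e4 := eyZ 2%N isT isT; have e5 := eyZ 3%N isT isT.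
apply: (given_by_P10 sb) => [j||||].
- by rewrite xL.
- by rewrite ez et lpow2_abelian.
- by rewrite ez et (mul_mod_center t'Z e2) (mul_mod_center t'Z e3)
    (phi_mod_center z'Z e2 e3).
- by rewrite ez et (mul_mod_center z'Z e4) (mul_mod_center z'Z e5)
    (phi_mod_center t'Z e4 e5).
by rewrite (phi_mod_center e2 e3 e4) (phi_mod_center e2 e3 e5)
  (phi_mod_center e4 e5 e2) (phi_mod_center e4 e5 e3).
Qed.

End General.

(** * Algebras with the same presentation are isomorphic *)

Section Transport.
Variables (F : fieldType) (n : nat).

Lemma standard_basis_ind (L : saa F) (e : 'I_n + 'I_n -> L) (P : L -> Prop) :
  standard_basis e -> P 0 -> (forall k u v, P u -> P v -> P (k *: u + v)) ->
  (forall c, P (e c)) -> forall u, P u.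
Proof.
case=> eB _ _ _ P0 PD Pe u.
apply: (@span_ind _ _ P (codom e) P0 PD) => [v /codomP[c ->]|]; first exact: Pe.
by rewrite (span_basis eB) memvf.
Qed.

(** The linear map sending e to e', written with the dual basis of e: the
    coordinates of u along x_i and y_i are (u, y_i) and (x_i, u). *)
Definition transport (L M : saa F) (e : 'I_n + 'I_n -> L)
    (e' : 'I_n + 'I_n -> M) (u : L) : M :=
  \sum_i (form L u (e (inr i)) *: e' (inl i) +
          form L (e (inl i)) u *: e' (inr i)).

Section Pair.
Variables (L M : saa F) (e : 'I_n + 'I_n -> L) (e' : 'I_n + 'I_n -> M).
Hypotheses (sb : standard_basis e) (sb' : standard_basis e').
Local Notation f := (transport e e').

Lemma transport_linear : linear f.
Proof.
move=> k u v; rewrite /transport scaler_sumr -big_split;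
  apply: eq_bigr => i _ /=.
rewrite linearPr linearPl /= !scalerDl scalerDr !scalerA.
by rewrite addrACA.
Qed.

Lemma transport_basis c : f (e c) = e' c.
Proof.
case: sb => _ xx yy xy; rewrite /transport; case: c => i; rewrite (bigD1 i) //=.
  rewrite xy eqxx xx scale1r scale0r addr0 big1 ?addr0 // => j ij.
  by rewrite xy xx eq_sym (negPf ij) !scale0r addr0.
rewrite xy eqxx yy scale1r scale0r add0r big1 ?addr0 // => j ij.
by rewrite xy yy (negPf ij) !scale0r addr0.
Qed.

Lemma transport0 : f 0 = 0.
Proof.
by rewrite /transport big1 // => i _; rewrite linear0l linear0r !scale0r addr0.
Qed.

Lemma transport_form u v : form M (f u) (f v) = form L u v.
Proof.
apply: (standard_basis_ind sb (P := fun u => form M (f u) (f v) = form L u v))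
  u.
- by rewrite transport0 !linear0l.
- by move=> k u w hu hw; rewrite transport_linear !linearPl /= hu hw.
move=> c; apply: (standard_basis_ind sb (P := fun v =>
  form M (f (e c)) (f v) = form L (e c) v)) v.
- by rewrite transport0 !linear0r.
- by move=> k u w hu hw; rewrite transport_linear !linearPr /= hu hw.
move=> d; rewrite !transport_basis.
case: sb sb' => _ xx yy xy [_ xx' yy' xy'].
case: c d => [i|i] [j|j]; rewrite ?xx ?xx' ?yy ?yy' ?xy ?xy' //.
by rewrite form_opp xy' [RHS]form_opp xy.
Qed.

Lemma transport_phi :
  (forall a b c, phi (e a) (e b) (e c) = phi (e' a) (e' b) (e' c)) ->
  forall u v w, phi (f u) (f v) (f w) = phi u v w.
Proof.
move=> ee' u v w.
have phi0 (N : saa F) (x y : N) :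
    (phi 0 x y = 0) * (phi x 0 y = 0) * (phi x y 0 = 0).
  by rewrite /phi !(linear0l, linear0r).
apply: (standard_basis_ind sb (P := fun u => phi (f u) (f v) (f w) = phi u v
  w)) u.
- by rewrite transport0 !phi0.
- by move=> k x y hx hy; rewrite transport_linear !phi_lin hx hy.
move=> a; apply: (standard_basis_ind sb (P := fun v =>
  phi (f (e a)) (f v) (f w) = phi (e a) v w)) v.
- by rewrite transport0 !phi0.
- by move=> k x y hx hy; rewrite transport_linear !phi_lin hx hy.
move=> b; apply: (standard_basis_ind sb (P := fun w =>
  phi (f (e a)) (f (e b)) (f w) = phi (e a) (e b) w)) w.
- by rewrite transport0 !phi0.
- by move=> k x y hx hy; rewrite transport_linear !phi_lin hx hy.
by move=> c; rewrite !transport_basis.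
Qed.

End Pair.

Lemma transportK (L M : saa F) (e : 'I_n + 'I_n -> L) (e' : 'I_n + 'I_n -> M) :
  standard_basis e -> standard_basis e' ->
  cancel (transport e e') (transport e' e).
Proof.
move=> sb sb' u; apply: (standard_basis_ind sb (P := fun u =>
  transport e' e (transport e e' u) = u)) u.
- by rewrite !transport0.
- by move=> k x y hx hy; rewrite !transport_linear hx hy.
by move=> c; rewrite !transport_basis.
Qed.

(** The difference of the two trilinear forms on basis triples is alternating
    and vanishes on the listed triples, hence on their reorderings, and both
    forms are 0 elsewhere. Transporting the basis then preserves the form and
    phi, and by non-degeneracy phi determines the product. *)
Lemma given_by_iso (L M : saa F) (P : presentation F n) :
  given_by L P -> given_by M P -> saa_iso L M.
Proof.
case=> e [sb eP e0] [e' [sb' eP' e0']].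
have ee' a b c : phi (e a) (e b) (e c) = phi (e' a) (e' b) (e' c).
  pose D a b c := phi (e a) (e b) (e c) - phi (e' a) (e' b) (e' c).
  apply/eqP; rewrite -subr_eq0 -/(D a b c); apply/eqP.
  have [/hasP[[[[a' b'] c'] r] inP pe] | /hasPn nP] := boolP (has
      (fun p : _ * _ * _ * F => perm_eq [:: a; b; c] [:: p.1.1.1; p.1.1.2;
        p.1.2]) P).
    apply: (alternating_perm_eq0 _ _ pe) => [x y z|x y z|].
    - by rewrite /D [in LHS]phi_rot [phi (e' x) _ _]phi_rot.
    - by rewrite /D phi_swap [phi (e' x) _ _]phi_swap opprB opprK addrC.
    by rewrite /D /phi (eP _ _ _ _ inP) (eP' _ _ _ _ inP) subrr.
  by rewrite /D /phi e0 ?e0' ?subrr // => a' b' c' r /nP.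
pose f := HB.pack_for {linear L -> M} (transport e e')
  (GRing.isLinear.Build _ _ _ _ _ (transport_linear e e')).
exists f; split.
- by exists (transport e' e); apply: transportK.
- move=> u v; apply/eqP; rewrite -subr_eq0; apply/eqP/form_nondeg => w.
  rewrite -(transportK sb' sb w) linearBl /= -[mul M _ _]/(mul M (transport e
    e' u) (transport e e' v)).
  by rewrite transport_form // -[form M _ _]/(phi _ _ _) transport_phi // subrr.
by move=> u v; apply: transport_form.
Qed.

End Transport.

(** * The algebra of the presentation in coordinates *)

Section Model.
Variable F : fieldType.
Local Notation V := 'rV[F]_10.
Implicit Types u v w : V.

(** The coordinate i < 5 belongs to x_(i+1) and the coordinate i + 5 to
    y_(i+1). Indices are natural numbers so that closed comparisons of indices
    compute. *)
Definition entry (u : V) (i : nat) : F := u 0 (inord i).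
Definition evec (i : nat) : V := delta_mx 0 (inord i).

Definition minor (i j : nat) u v :=
  entry u i * entry v j - entry u j * entry v i.

Definition model_form u v : F := \sum_(i < 5) minor i (i + 5) u v.

(** Solving (uv, w) = phi u v w, where phi is the sum of the 3 x 3
    determinants on the coordinates of (x1, y2, y3), indices 0, 6, 7, and of
    (y1, y4, y5), indices 5, 8, 9: the coordinate of uv along x_i is the
    coefficient of the coordinate of w along y_i, and the one along y_i is
    minus the coefficient of the coordinate of w along x_i. *)
Definition model_mul u v : V :=
  minor 8 9 u v *: evec 0 + minor 7 0 u v *: evec 1 +
  minor 0 6 u v *: evec 2 + minor 9 5 u v *: evec 3 +
  minor 5 8 u v *: evec 4 + minor 7 6 u v *: evec 5.

Lemma entry_lin i k u v : entry (k *: u + v) i = k * entry u i + entry v i.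
Proof. by rewrite /entry !mxE. Qed.

Lemma entry_evec i j : (i < 10)%N -> (j < 10)%N ->
  entry (evec i) j = (j == i)%:R.
Proof.
by move=> i10 j10; rewrite /entry /evec mxE eqxx /= -val_eqE /= !inordK.
Qed.

Lemma minor_linl i j k u u' v : minor i j (k *: u + u') v =
  k * minor i j u v + minor i j u' v.
Proof. by rewrite /minor !entry_lin; ring. Qed.

Lemma minor_linr i j k u v v' : minor i j u (k *: v + v') =
  k * minor i j u v + minor i j u v'.
Proof. by rewrite /minor !entry_lin; ring. Qed.

Lemma model_form_bilinear : bilinear_for *%R *%R model_form.
Proof.
split=> [v k u u' | u k v v'] /=; rewrite /model_form mulr_sumr -big_split;
  apply: eq_bigr => i _.
  exact: minor_linl.
exact: minor_linr.
Qed.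

Lemma model_mul_bilinear : bilinear_for *:%R *:%R model_mul.
Proof.
split=> [v k u u' | u k v v'] /=; rewrite /model_mul !(minor_linl, minor_linr).
all: move: (evec 0) (evec 1) (evec 2) (evec 3) (evec 4) (evec 5) =>
  b0 b1 b2 b3 b4 b5.
all: by apply/rowP=> i; rewrite !mxE; ring.
Qed.

HB.instance Definition _ := bilinear_isBilinear.Build F V V F *%R *%R model_form
  model_form_bilinear.
HB.instance Definition _ := bilinear_isBilinear.Build F V V V *:%R *:%R
  model_mul model_mul_bilinear.

Lemma model_formE u v : model_form u v =
  minor 0 5 u v + minor 1 6 u v + minor 2 7 u v + minor 3 8 u v + minor 4 9 u v.
Proof.
by rewrite /model_form !big_ord_recl big_ord0 /= /bump /= addr0 !addrA.
Qed.

Lemma entry_inj u v : (forall i, (i < 10)%N -> entry u i = entry v i) -> u = v.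
Proof.
move=> uv; apply/rowP=> i; have := uv i (ltn_ord i).
by rewrite /entry inord_val.
Qed.

Lemma entry_mul u v i : (i < 10)%N -> entry (model_mul u v) i =
  nth 0 [:: minor 8 9 u v; minor 7 0 u v; minor 0 6 u v; minor 9 5 u v;
            minor 5 8 u v; minor 7 6 u v] i.
Proof.
move=> i10; rewrite {1}/entry !mxE -!/(entry _ _) /= -!val_eqE /= !inordK //.
by case: i i10 => [|[|[|[|[|[|[|[|[|[|//]]]]]]]]]] _;
  rewrite /= ?mulr1 ?mulr0 ?addr0 ?add0r.
Qed.

Lemma minor_evec_r i j k u : (k < 10)%N -> (i < 10)%N -> (j < 10)%N ->
  minor i j u (evec k) = entry u i * (j == k)%:R - entry u j * (i == k)%:R.
Proof. by move=> k10 i10 j10; rewrite /minor !entry_evec. Qed.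

Lemma model_form_alt u : model_form u u = 0.
Proof. by rewrite model_formE /minor; ring. Qed.

Lemma entry_form u :
  (forall i, (i < 5)%N -> entry u i = model_form u (evec (i + 5))) /\
  (forall i, (i < 5)%N -> entry u (i + 5) = - model_form u (evec i)).
Proof.
by split=> [] [|[|[|[|[|//]]]]] _; rewrite model_formE !minor_evec_r //=; ring.
Qed.

Lemma model_form_nondeg u : (forall v, model_form u v = 0) -> u = 0.
Proof.
move=> u0; have [ux uy] := entry_form u; apply: entry_inj => i i10.
rewrite [RHS]mxE; have [i5|i5] := ltnP i 5; first by rewrite ux.
by rewrite -(subnK i5) uy ?u0 ?oppr0 // -(ltn_add2r 5) subnK.
Qed.

Lemma model_mul_alt u : model_mul u u = 0.
Proof.
by apply: entry_inj => i i10; rewrite entry_mul // [RHS]mxE /minor;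
  case: i i10 => [|[|[|[|[|[|[|[|[|[|//]]]]]]]]]] _ //=; ring.
Qed.

Lemma model_form_mul u v w :
  model_form (model_mul u v) w = model_form (model_mul v w) u.
Proof. by rewrite !model_formE /minor !entry_mul //= /minor; ring. Qed.

Definition model : saa F := @SAA F V model_form model_mul
  model_form_alt model_form_nondeg model_mul_alt model_form_mul.

Lemma model_center (u : model) : u \in center model <->
  all (fun i => entry u i == 0) [:: 0; 5; 6; 7; 8; 9].
Proof.
rewrite memv_center; split=> [uZ|].
  have ub i j : (i < 10)%N -> entry (model_mul u (evec j)) i = 0.
    by move=> _; rewrite (uZ (evec j)) /entry mxE.
  move: (ub 0 9 isT) (ub 1 0 isT) (ub 2 6 isT) (ub 0 8 isT) (ub 3 9 isT) (ub 5
    7 isT).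
  rewrite !entry_mul //= !minor_evec_r //= !(mulr0, mulr1, subr0, sub0r).
  move=> -> -> -> /eqP + /eqP + /eqP.
  by rewrite !oppr_eq0 eqxx => -> -> ->.
case/and5P=> /eqP u0 /eqP u5 /eqP u6 /eqP u7 /and3P[/eqP u8 /eqP u9 _] y.
apply: entry_inj => i i10; rewrite entry_mul // /minor u0 u5 u6 u7 u8 u9 !mul0r
  !subrr /entry mxE.
by case: i i10 => [|[|[|[|[|[|[|[|[|[|//]]]]]]]]]] _.
Qed.

Lemma evec_center i : (0 < i < 5)%N -> (evec i : model) \in center model.
Proof.
case: i => [|[|[|[|[|//]]]]] // _.
all: by apply/model_center; rewrite /= !entry_evec //= eqxx.
Qed.

(** L^2 is the orthogonal of the center, and the center is spanned by x2, ...,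
    x5. *)
Lemma model_lpow2 (u : model) : u \in lpow model 2 <->
  all (fun i => entry u i == 0) [:: 6; 7; 8; 9].
Proof.
have cu i : form model (evec i) u = - form model u (evec i) by rewrite form_opp.
have [ux uy] := entry_form u.
split=> [u2 | /and5P[/eqP u6 /eqP u7 /eqP u8 /eqP u9 _]].
  have uZ i : (0 < i < 5)%N -> entry u (i + 5) = 0.
    move=> i5; rewrite uy -?cu ?[form _ _ _]center_perp ?evec_center //.
    by case/andP: i5.
  by rewrite /= !(uZ 1%N, uZ 2%N, uZ 3%N, uZ 4%N) ?eqxx.
apply: perp_center => c /model_center.
case/and5P=> /eqP c0 /eqP c5 /eqP c6 /eqP c7 /and3P[/eqP c8 /eqP c9 _].
change (model_form c u = 0).
by rewrite model_formE /minor u6 u7 u8 u9 c0 c5 c6 c7 c8 c9; ring.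
Qed.

Lemma model_lpow3 : lpow model 3 = center model.
Proof.
apply/eqP; rewrite eqEsubv; apply/andP; split.
  apply/prod_vsP=> u v /model_lpow2 /and5P[/eqP u6 /eqP u7 /eqP u8 /eqP u9 _] _.
  apply/model_center.
  rewrite -[mul model u v]/(model_mul u v) /= !entry_mul //=.
  by rewrite /minor u6 u7 u8 u9 !mul0r subrr eqxx.
have vec_lpow3 i j (k : F) l :
    all (fun l => entry (evec i) l == 0) [:: 6; 7; 8; 9] ->
    model_mul (evec i) (evec j) = k *: evec l -> k != 0 ->
    (evec l : model) \in lpow model 3.
  move=> /model_lpow2 i2 ij k0; rewrite -[evec l](scalerK k0) -ij; apply: memvZ.
  exact: (prod_vsP _ _ _ (subvv (lpow model 3)) (evec i) (evec j) i2 (memvf _)).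
have mul_evec i j k l :
   all (fun m => entry (model_mul (evec i) (evec j)) m == k * entry (evec l) m)
     (iota 0 10) ->
   model_mul (evec i) (evec j) = k *: evec l.
  move=> /allP h; apply: entry_inj => m m10; rewrite [RHS]/entry mxE;
    apply/eqP/h.
  by rewrite mem_iota.
apply/subvP=> u /model_center.
case/and5P=> /eqP c0 /eqP c5 /eqP c6 /eqP c7 /and3P[/eqP c8 /eqP c9 _].
have -> : u = (entry u 1 *: evec 1 + entry u 2 *: evec 2 +
    entry u 3 *: evec 3 + entry u 4 *: evec 4 : V) :> V.
  apply: entry_inj => i i10; rewrite /entry !mxE -!/(entry _ _) -!val_eqE /=
    !inordK //.
  by case: i i10 => [|[|[|[|[|[|[|[|[|[|//]]]]]]]]]] _;
    rewrite /= ?mulr1 ?mulr0 ?addr0 ?add0r.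
(* x1 y3 = - x2, x1 y2 = x3, y1 y5 = - x4, y1 y4 = x5; x1 and y1 are in L^2 *)
by rewrite !memvD // memvZ //;
  [apply: (vec_lpow3 0 7 (-1)) | apply: (vec_lpow3 0 6 1) | apply:
    (vec_lpow3 5 9 (-1)) | apply: (vec_lpow3 5 8 1)];
  rewrite ?oppr_eq0 ?oner_eq0 //; try apply: mul_evec;
    rewrite /= ?entry_mul //=;
  rewrite /minor !entry_evec //= ?eqxx // !(mul0r, mulr0, mulr1, mulN1r,
    subr0, sub0r, oppr0, addr0) ?eqxx.
Qed.

Lemma dim_model : \dim {:model} = 10%N.
Proof. by rewrite dimvf /dim /= mul1n. Qed.

Lemma model_isotropic : isotropic (center model).
Proof.
move=> u v /model_center /and5P[_ /eqP u5 /eqP u6 /eqP u7 /and3P[/eqP u8 /eqP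
  u9 _]].
case/model_center/and5P=> _ /eqP v5 /eqP v6 /eqP v7 /and3P[/eqP v8 /eqP v9 _].
rewrite -[LHS]/(model_form u v) model_formE /minor.
by rewrite u5 u6 u7 u8 u9 v5 v6 v7 v8 v9; ring.
Qed.

Lemma free_evecs_mod n (s : n.-tuple nat) (W : {vspace model}) :
  uniq s -> all (gtn 10) s ->
  (forall u : model, u \in W -> all (fun i => entry u i == 0) s) ->
  free (map evec s : seq model) /\ (<<map evec s : seq model>> :&: W = 0)%VS.
Proof.
move=> us s10 sW; apply: (@indep_mod _ model _ (map_tuple evec s)) => k kW j.
have j10 i : (i < n)%N -> (nth 0 s i < 10)%N.
  by move=> jn; move/allP: s10; apply; rewrite mem_nth ?size_tuple.
have /allP/(_ (nth 0 s j)) := sW _ kW.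
rewrite mem_nth ?size_tuple // => /(_ isT) /eqP <-.
have entry_sum (I : finType) (G : I -> V) l :
  entry (\sum_i G i) l = \sum_i entry (G i) l.
  by rewrite /entry summxE.
rewrite entry_sum (bigD1 j) //= (nth_map 0%N) ?size_tuple //.
have entryZ c u l : entry (c *: u) l = c * entry u l by rewrite /entry mxE.
rewrite entryZ entry_evec ?j10 // eqxx mulr1 big1 ?addr0 // => i ij.
rewrite (nth_map 0%N) ?size_tuple // entryZ entry_evec ?j10 //.
by rewrite nth_uniq ?size_tuple // -val_eqE eq_sym in ij *;
  rewrite (negPf ij) mulr0.
Qed.

(** The six basis vectors other than x2, ..., x5 are independent modulo the
    center, which bounds its dimension from above. *)
Lemma dim_model_center : \dim (center model) = 4%N.
Proof.
have [|fc _] := @free_evecs_mod 4 [tuple 1; 2; 3; 4]%N 0%VS isT isT.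
  by move=> u; rewrite memv0 => /eqP->; apply/allP=> i _; rewrite /entry mxE.
have [|fd dis] := @free_evecs_mod 6 [tuple 0; 5; 6; 7; 8;
  9]%N (center model) isT isT.
  by move=> u /model_center.
apply/eqP; rewrite eqn_leq; apply/andP; split.
  rewrite -(leq_add2l 6) -[X in (X + _)%N](eqP fd) -dimv_disjoint_sum //.
  by apply: leq_trans (dimvS (subvf _)) _; rewrite dim_model.
rewrite -[X in (X <= _)%N](eqP fc); apply/dimvS/span_subvP=> _ /mapP[i i4 ->].
by apply: evec_center; move: i4; rewrite !inE => /or4P[] /eqP->.
Qed.

Lemma model_saa_10_4 : saa_10_4 model.
Proof.
split; [|exact: dim_model|exact: model_isotropic|exact:
  dim_model_center|exact: model_lpow3].
exists 3; apply/eqP; rewrite -subv0 -[lpow _ _]/(prod_vs (lpow model 3) fullv)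
  model_lpow3.
by apply/prod_vsP=> u v /memv_center -> _; rewrite mem0v.
Qed.

(** The basis of L^2 modulo the center is x1, y1; the radical of phi x1
    contains y4, and that of phi y1 contains y2. *)
Lemma model_type_A : type_A model.
Proof.
have z2 : (evec 0 : model) \in lpow model 2 by apply/model_lpow2;
  rewrite /= !entry_evec //= eqxx.
have t2 : (evec 5 : model) \in lpow model 2 by apply/model_lpow2;
  rewrite /= !entry_evec //= eqxx.
have [|fr dis] := @free_evecs_mod 2 [tuple 0; 5]%N (center model) isT isT.
  by move=> u /model_center /and3P[/eqP u0 /eqP u5 _]; rewrite /= u0 u5 eqxx.
exists (evec 0), (evec 5); split.
- split=> //; apply/eqP; rewrite eqEdim; apply/andP; split.
    rewrite subv_add; apply/andP; split.
      by apply/span_subvP=> u; rewrite !inE => /orP[] /eqP ->.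
    apply/subvP=> u; exact: (center_sub_lpow2 model_lpow3).
  rewrite dimv_disjoint_sum // (eqP fr) dim_model_center.
  rewrite -(leq_add2r (\dim (center model))) dim_lpow2_center.
  by rewrite dim_model dim_model_center.
- exists (evec 8); first by apply/negP=> /model_lpow2;
  rewrite /= !entry_evec //= oner_eq0 !andbF.
  move=> v; change (model_form (model_mul (evec 0) (evec 8)) v = 0).
  rewrite model_formE /minor !entry_mul //= /minor !entry_evec //=; ring.
exists (evec 6); first by apply/negP=> /model_lpow2;
  rewrite /= !entry_evec //= oner_eq0.
move=> v; change (model_form (model_mul (evec 5) (evec 6)) v = 0).
rewrite model_formE /minor !entry_mul //= /minor !entry_evec //=; ring.
Qed.

End Model.

(** * Existence and uniqueness *)

Theorem proposition6p4 (F : fieldType) :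
  [/\ exists L : saa F, saa_10_4 L /\ type_A L,
      forall L M : saa F, saa_10_4 L -> type_A L -> saa_10_4 M -> type_A M ->
        saa_iso L M
    & forall L : saa F, saa_10_4 L -> type_A L -> given_by L (P10_4_2 F)].
Proof.
split=> [|L M L10 LA M10 MA|L L10 LA].
- by exists (model F); split; [exact: model_saa_10_4 | exact: model_type_A].
- exact: given_by_iso (type_A_given_by L10 LA) (type_A_given_by M10 MA).
exact: type_A_given_by.
Qed.
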